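(* Let $(\Omega,\mathcal{F},P)$ be a probability space and let $(\mathcal{F}_n)_{n\ge 1}$ be an increasing sequence of sub-$\sigma$-algebras of $\mathcal{F}$. For $n=1,2,\dots$ let $X_n$ be an $\mathcal{F}_n$-measurable real-valued random variable, let $T_n:\mathbb{R}^n\to\mathbb{R}$ be a Borel measurable function, and let $W_n$ be an $\mathcal{F}_{n+1}$-measurable real-valued random variable such that $$X_{n+1}=T_n(X_1,\dots,X_n)+W_n .$$ Assume $\mathbb{E}[W_n\mid\mathcal{F}_n]=0$ almost surely for every $n$, and $\sum_{n=1}^\infty \mathbb{E}[W_n^2]<\infty$. Let $(\alpha_n),(\beta_n),(\gamma_n)$ be sequences of real numbers with $\alpha_n\ge0$, $\beta_n\ge0$, $\gamma_n\ge0$, $\lim_{n\to\infty}\alpha_n=0$, $\sum_{n=1}^\infty\beta_n<\infty$ and $\sum_{n=1}^\infty\gamma_n=\infty$. Suppose there is a point $x_*\in\mathbb{R}$ such that for all $n\ge1$ and all $x_1,\dots,x_n\in\mathbb{R}$, $$|T_n(x_1,\dots,x_n)-x_*|\le\max\big(\alpha_n,\,(1+\beta_n)|x_n-x_*|-\gamma_n\big).$$ Then $X_n\to x_*$ almost surely, i.e. $P\{\lim_{n\to\infty}X_n=x_*\}=1$.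
   Context: $\mathbb{E}[\,\cdot\mid\mathcal{F}_n]$ denotes conditional expectation with respect to the sub-$\sigma$-algebra $\mathcal{F}_n$. *)

(* Defs.v *)
From HB Require Import structures.
From mathcomp Require Import all_boot all_order all_algebra.
From mathcomp Require Import all_classical all_reals all_analysis.
Set Implicit Arguments. Unset Strict Implicit. Unset Printing Implicit Defensive.
Import Order.TTheory GRing.Theory Num.Theory.
Local Open Scope classical_set_scope.
Local Open Scope ring_scope.

Definition is_sub_sigma_algebra d (T : measurableType d) (G : set (set T)) :=
  sigma_algebra setT G /\ G `<=` measurable.

Definition measurable_wrt (T : Type) (R : realType) (G : set (set T))
    (X : T -> R) :=
  forall B : set R, measurable B -> G (X @^-1` B).

(* E[W | G] = 0 a.s.  (for integrable W): by the defining property of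
   conditional expectation, this means  \int_A W dP = 0  for all A in G. *)
Definition condexp_zero d (T : measurableType d) (R : realType)
    (P : probability T R) (G : set (set T)) (W : T -> R) :=
  P.-integrable setT (fun w => (W w)%:E) /\
  forall A, G A -> (\int[P]_(w in A) (W w)%:E = 0)%E.

(* Main.v *)
Require Import Defs.
From HB Require Import structures.
From mathcomp Require Import all_boot all_order all_algebra.
From mathcomp Require Import all_classical all_reals all_analysis.
From mathcomp Require Import measurable_realfun ring lra.
Set Implicit Arguments.
Unset Strict Implicit.
Unset Printing Implicit Defensive.
Import Order.TTheory GRing.Theory Num.Theory.
Import numFieldTopology.Exports.
Local Open Scope classical_set_scope.
Local Open Scope ring_scope.

(** Put [p n := exp (\sum_(k < n) beta k)], which is bounded, and let [s n] be
    the sign of [T n - x*], which is known at time [n].  The variables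
    [delta n := s n * W n / p n.+1] are martingale differences with summable
    second moments, so [\sum_n delta n] converges almost surely; in particular
    [W n] tends to [0].  On a path where this happens, either [|T n - x*|] is at
    most [max (alpha n) |W n|], or [T n - x*] has the sign of [X n.+1 - x*] and
    [|X n.+1 - x*| = |T n - x*| + s n * W n].  Hence [eta n := |X n - x*| / p n]
    satisfies [eta n.+1 <= max (a n) (eta n + delta n - c n)] with [a n]
    tending to [0] and [\sum_n c n] infinite, which forces [eta n] to [0]. *)

(** * Measurability relative to a sub-sigma-algebra *)

(** Makes the closure properties of [measurable_fun] available relative to [G]. *)
Lemma measurable_wrtP {d} {T : measurableType d} {R : realType}
    {G : set (set T)} {X : T -> R} : is_sub_sigma_algebra G ->
  measurable_wrt G X <->
  measurable_fun [set: g_sigma_algebraType G] (X : g_sigma_algebraType G -> R).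
Proof.
move=> [sG _]; have GE := measurable_g_measurableTypeE sG.
split=> [GX _ B mB|mX B mB].
  by rewrite setTI GE; exact: GX.
by rewrite -[X in X _]GE -[X in measurable X]setTI; exact: mX.
Qed.

Lemma measurable_wrt_fun {d} {T : measurableType d} {R : realType}
    {G : set (set T)} {X : T -> R} : is_sub_sigma_algebra G ->
  measurable_wrt G X -> measurable_fun [set: T] X.
Proof. by move=> [_ Gm] GX _ B mB; rewrite setTI; exact/Gm/GX. Qed.

Lemma measurable_wrt_comp (T : Type) (R : realType) (G : set (set T))
    (X : T -> R) (f : R -> R) :
  measurable_fun [set: R] f -> measurable_wrt G X -> measurable_wrt G (f \o X).
Proof.
move=> mf GX B mB; rewrite comp_preimage; apply: GX.
by rewrite -[X in measurable X]setTI; exact: mf.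
Qed.

Lemma sub_sigma_algebra_setT {d} {T : measurableType d} (G : set (set T)) :
  is_sub_sigma_algebra G -> G setT.
Proof. by move=> [[G0 GC _] _]; rewrite -(setD0 setT); exact: GC. Qed.

Lemma measurable_norm_ge {d} {T : measurableType d} {R : realType}
    (X : T -> R) (c : R) : measurable_fun [set: T] X ->
  measurable [set w | c <= `|X w|].
Proof.
move=> mX; have := measurableT_comp (@normr_measurable R setT) mX.
move=> /(_ measurableT `[c, +oo[%classic (measurable_itv _)); rewrite setTI.
by congr measurable; apply/seteqP; split=> w /=; rewrite in_itv/= andbT.
Qed.

(** * A deterministic recursion *)

(** Once [series delta] is subtracted, the second branch of the maximum is a decrease by [c n],
    which cannot persist because [series c] diverges. The first branch resets [eta] to a small
    value, from which the nearly constant tail of [series delta] lifts it only slightly. *)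
Lemma max_recursion_cvg0 (R : realType) (eta a c delta : nat -> R) :
  (forall n, 0 <= eta n) -> a @ \oo --> (0 : R) ->
  (forall n, 0 <= c n) -> series c @ \oo --> +oo ->
  cvgn (series delta) ->
  (forall n, eta n.+1 <= Num.max (a n) (eta n + delta n - c n)) ->
  eta @ \oo --> (0 : R).
Proof.
move=> eta0 a0 c0 cy /cvg_ex[/= l Sl] rec.
apply/cvgrPdist_le => e e0.
have e5 : 0 < e / 5 by rewrite divr_gt0.
have [m _ Hm] : \forall n \near \oo, a n <= e / 5 /\ `|l - series delta n| <= e / 5.
  near=> n; split.
  - have : `|0 - a n| <= e / 5 by near: n; move/cvgrPdist_le: a0; apply.
    by rewrite sub0r normrN; exact/le_trans/ler_norm.
  - by near: n; move/cvgrPdist_le: Sl; apply.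
(* The first bound accounts for a reset after [m]: there [eta] is at most [e / 5] and [series delta]
   at least [l - e / 5]. The second follows a path not reset since [m]. *)
have key n : (m <= n)%N ->
    eta n - series delta n <= Num.max (3 / 5 * e - l)
      (eta m - series delta m - (series c n - series c m)).
  elim: n => [|n IH].
    by rewrite leqn0 => /eqP ->; rewrite subrr subr0 le_max lexx orbT.
  rewrite leq_eqVlt => /predU1P[<-|]; first by rewrite subrr subr0 le_max lexx orbT.
  rewrite ltnS => mn; have {}IH := IH mn.
  have [an _] := Hm n mn; have [_] := Hm n.+1 (leqW mn).
  move: (rec n) (c0 n) IH; rewrite !seriesSr !le_max => /orP[h|h] cn IH /ler_normlP[h1 h2].
    by apply/orP; left; lra.
  by case/orP: IH => IH; apply/orP; [left|right]; lra.
near=> n.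
have mn : (m <= n)%N by near: n; exact: nbhs_infty_ge.
have cn : eta m - series delta m + series c m - (3 / 5 * e - l) <= series c n.
  by near: n; move/cvgryPge: cy; apply.
have [_ /ler_normlP[h1 h2]] := Hm n mn.
rewrite sub0r normrN ger0_norm //.
by have := key n mn; rewrite le_max => /orP[h|h]; lra.
Unshelve. all: by end_near.
Qed.

(** * Bounded multipliers of centered variables *)

Lemma integrable_bounded_mul {d} {T : measurableType d} {R : realType}
    (mu : {measure set T -> \bar R}) (V W : T -> R) (M : R) :
  measurable_fun [set: T] V -> (forall w, `|V w| <= M) ->
  mu.-integrable setT (EFin \o W) ->
  mu.-integrable setT (EFin \o (fun w => V w * W w)).
Proof.
move=> mV VM iW.
have mW : measurable_fun setT W by apply/measurable_EFinP; exact: measurable_int iW.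
apply: (le_integrable measurableT _ _ (integrableZl measurableT M iW)).
  by apply/measurable_EFinP; exact: measurable_funM.
move=> w _; rewrite /= lee_fin !normrM ler_wpM2r//.
exact: le_trans (VM w) (ler_norm M).
Qed.

(** [condexp_zero] tests [W] only against indicators of sets of [G]. Binary expansion reduces [V] to
    such indicators, and the remainder after [n] digits contributes at most [2^-1 ^+ n] times the
    mean of [|W|]. *)
Lemma Rintegral_unit_mul_condexp_zero {d} {T : measurableType d} {R : realType}
    (P : probability T R) (G : set (set T)) (V W : T -> R) :
  is_sub_sigma_algebra G -> condexp_zero P G W -> measurable_wrt G V ->
  (forall w, 0 <= V w <= 1) -> \int[P]_w (V w * W w) = 0.
Proof.
move=> sG [iW W0] GV V01.
have mnorm (U : T -> R) : (forall w, 0 <= U w <= 1) -> forall w, `|U w| <= 1.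
  by move=> U01 w; have /andP[? ?] := U01 w; rewrite ger0_norm.
(* Peeling off the leading binary digit of [V] halves the integral. *)
have bound n : forall U : T -> R, measurable_wrt G U -> (forall w, 0 <= U w <= 1) ->
    `|\int[P]_w (U w * W w)| <= 2^-1 ^+ n * \int[P]_w `|W w|.
  elim: n => [|n IH] U GU U01.
    have iUW := integrable_bounded_mul (measurable_wrt_fun sG GU) (mnorm _ U01) iW.
    rewrite expr0 mul1r; apply: le_trans (le_normr_Rintegral measurableT iUW) _.
    apply: le_Rintegral => //.
    - exact: integrable_norm iUW.
    - exact: integrable_norm iW.
    - by move=> w _; rewrite normrM ler_piMl// mnorm.
  (* The doubling map: [U] is half of [\1_A + f \o U], and [f \o U] is again [[0, 1]]-valued, so the
     induction hypothesis applies to it. *)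
  pose f (x : R) : R := 2 * x - \1_(`[2^-1, +oo[%classic : set R) x.
  have mf : measurable_fun setT f.
    by apply: measurable_funB => //; exact: measurable_funM.
  pose A := U @^-1` `[2^-1, +oo[%classic.
  have GA : G A by apply: GU; exact: measurable_itv.
  have mA : measurable A := sG.2 _ GA.
  have GfU := measurable_wrt_comp mf GU.
  have fU01 w : 0 <= (f \o U) w <= 1.
    have /andP[U0 U1] := U01 w.
    by rewrite /= /f indicE mem_setE in_itv/= andbT; case: (leP 2^-1 (U w)) => h /=; lra.
  have iA : P.-integrable setT (EFin \o (W \_ A)).
    rewrite -restrict_EFin; apply/(integrable_mkcond _ mA).
    exact: integrableS iW.
  have ifU := integrable_bounded_mul (measurable_wrt_fun sG GfU) (mnorm _ fU01) iW.
  have -> : \int[P]_w (U w * W w) = 2^-1 * \int[P]_w (f (U w) * W w).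
    transitivity (\int[P]_w (2^-1 * ((f (U w) * W w) + (W \_ A) w))).
      apply: eq_Rintegral => w _; rewrite patch_indic /= /f !indicE.
      have -> : (w \in A) = (U w \in `[2^-1, +oo[%classic).
        by apply/idP/idP; rewrite !inE.
      by case: (_ \in _) => /=; lra.
    rewrite RintegralZl//; last exact: (integrableD measurableT ifU iA).
    by rewrite RintegralD// -Rintegral_mkcond {2}/Rintegral W0//= addr0.
  by rewrite normrM exprS -mulrA ger0_norm// ler_wpM2l//; exact: IH.
apply/eqP; rewrite -normr_le0.
have h : (fun n => 2^-1 ^+ n * \int[P]_w `|W w|) @ \oo --> (0 : R).
  rewrite -[X in _ --> X](mul0r (\int[P]_w `|W w|)); apply: cvgMr_tmp.
  by apply: cvg_expr; rewrite ger0_norm// invf_lt1// ltr1n.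
apply: (cvgr_to_ge h); near=> n; exact: bound.
Unshelve. all: by end_near.
Qed.


(** A known bounded factor can be pulled out: [V * \1_A] is an affine function of a [[0, 1]]-valued
    [U], and the constant term contributes a multiple of the mean of [W], which is zero. *)
Lemma condexp_zero_mul {d} {T : measurableType d} {R : realType}
    (P : probability T R) (G : set (set T)) (V W : T -> R) (M : R) :
  is_sub_sigma_algebra G -> condexp_zero P G W -> measurable_wrt G V ->
  (forall w, `|V w| <= M) -> condexp_zero P G (fun w => V w * W w).
Proof.
move=> sG cW GV VM; have [iW W0] := cW.
have mV := measurable_wrt_fun sG GV.
have iVW := integrable_bounded_mul mV VM iW.
split=> // A GA; have mA : measurable A := sG.2 _ GA.
rewrite -[LHS]fineK; last first.
  by apply: integrable_fin_num => //; exact: integrableS iVW.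
congr (_%:E); rewrite -[LHS]/(\int[P]_(w in A) (V w * W w)) Rintegral_mkcond.
(* The [+ 1] keeps [K] positive, so that [U] can rescale [[-K, K]] to [[0, 1]]. *)
pose K := `|M| + 1.
have K0 : 0 < K by rewrite ltr_wpDl.
pose U w := (2 * K)^-1 * (V w * \1_A w + K).
have GU : measurable_wrt G U.
  apply/(measurable_wrtP sG); apply: measurable_funM => //.
  apply: measurable_funD => //; apply: measurable_funM.
    exact/(measurable_wrtP sG).
  apply: measurable_indic.
  by rewrite measurable_g_measurableTypeE//; exact: (sG.1).
have UK w : `|V w * \1_A w| <= K.
  rewrite normrM; apply: (@le_trans _ _ `|V w|).
    by rewrite ler_piMr// indicE; case: (_ \in _); rewrite ?normr1 ?normr0.
  by apply: (le_trans (VM w)); rewrite /K (le_trans (ler_norm M))// lerDl.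
have U01 w : 0 <= U w <= 1.
  have /ler_normlP[h1 h2] := UK w.
  rewrite /U mulr_ge0 ?invr_ge0 ?mulr_ge0 ?(ltW K0)//=; last by lra.
  by rewrite ler_pdivrMl ?mulr_gt0//; lra.
have iUW : P.-integrable setT (EFin \o (fun w => U w * W w)).
  apply: (integrable_bounded_mul (measurable_wrt_fun sG GU) (M := 1)) => // w.
  by have /andP[? ?] := U01 w; rewrite ger0_norm.
transitivity (\int[P]_w ((2 * K) * (U w * W w) - K * W w)).
  apply: eq_Rintegral => w _; rewrite patch_indic /= /U !mulrA divff ?mul1r.
    by rewrite mulrDl addrK mulrAC.
  by rewrite mulf_neq0// gt_eqF.
rewrite RintegralB//; [|exact: (integrableZl measurableT (2 * K) iUW)|exact: (integrableZl measurableT K iW)].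
rewrite !RintegralZl// (Rintegral_unit_mul_condexp_zero sG cW GU U01).
by rewrite /Rintegral (W0 _ (sub_sigma_algebra_setT sG)); rewrite /= !mulr0 subr0.
Qed.

(** * Kolmogorov's maximal inequality by stopping *)

Section stopped_sums.
Context {d : measure_display} {T : measurableType d} {R : realType}.
Variables (P : probability T R) (G : nat -> set (set T)) (D : nat -> T -> R).
Hypotheses (sG : forall n, is_sub_sigma_algebra (G n))
  (GS : forall n, G n `<=` G n.+1)
  (GD : forall n, measurable_wrt (G n.+1) (D n))
  (D0 : forall n, condexp_zero P (G n) (D n))
  (iD2 : forall n, P.-integrable setT (EFin \o (fun w => D n w ^+ 2))).

Let mD n : measurable_fun setT (D n).
Proof. exact: measurable_wrt_fun (GD n). Qed.

(* The partial sums frozen at their first exit from ]-eps, eps[: multiplying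
   each increment by a bounded predictable factor keeps it centered. *)
Fixpoint stopped_sum (eps : R) (n : nat) (w : T) : R :=
  if n is m.+1 then
    let z := stopped_sum eps m w in
    z + \1_(`]- eps, eps[%classic : set R) z * D m w
  else 0.

(** Only the [D k] with [k < n] enter, so the factor multiplying [D n] is known at time [n]. *)
Lemma measurable_wrt_stopped_sum eps n : measurable_wrt (G n) (stopped_sum eps n).
Proof.
elim: n => [|n IH]; first by apply/(measurable_wrtP (sG _)); exact: measurable_cst.
have {}IH : measurable_wrt (G n.+1) (stopped_sum eps n).
  by move=> B mB; exact/GS/IH.
apply/(measurable_wrtP (sG _)) => /=; apply: measurable_funD.
  exact/(measurable_wrtP (sG _)).
apply: measurable_funM; last exact/(measurable_wrtP (sG _)).
apply/(measurable_wrtP (sG _)).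
exact: (measurable_wrt_comp (f := \1_(`]- eps, eps[%classic : set R))).
Qed.

Let mN eps n : measurable_fun setT (stopped_sum eps n).
Proof. exact: measurable_wrt_fun (measurable_wrt_stopped_sum eps n). Qed.

(** Orthogonality of increments: the cross term has mean zero, so each step adds at most the second
    moment of [D n]. *)
Lemma stopped_sum_sqr eps n :
  P.-integrable setT (EFin \o (fun w => stopped_sum eps n w ^+ 2)) /\
  \int[P]_w stopped_sum eps n w ^+ 2 <= \sum_(k < n) \int[P]_w D k w ^+ 2.
Proof.
elim: n => [|n [iN IH]] /=.
  rewrite big_ord0; split.
    by rewrite (_ : _ \o _ = cst 0%E)//; [exact: integrable0|
       apply/funext => w /=; rewrite expr0n].
  by under eq_Rintegral do rewrite expr0n /=; rewrite Rintegral_cst// mul0r.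
set N := stopped_sum eps n in iN IH *; set I := \1__.
(* The indicator confines [N w] to []-eps, eps[], which makes the cross factor bounded. *)
pose V w := 2 * N w * I (N w).
have VM w : `|V w| <= 2 * `|eps|.
  rewrite /V /I indicE mem_setE in_itv/= !normrM normr_nat -mulrA ler_wpM2l//.
  case: (boolP (_ < _ < _)) => [/andP[h1 h2]|_]; last by rewrite normr0 mulr0.
  rewrite normr1 mulr1; apply: le_trans (ler_norm eps).
  by rewrite ler_norml !ltW.
have GV : measurable_wrt (G n) V.
  apply: (measurable_wrt_comp (f := fun x => 2 * x * I x)).
    by apply: measurable_funM; [exact: measurable_funM|exact: measurable_indic].
  exact: measurable_wrt_stopped_sum.
have [iVD VD0] := condexp_zero_mul (sG n) (D0 n) GV VM.
have iND := integrableD measurableT iN iVD.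
have iR := integrableD measurableT iND (iD2 n).
have le w : (N w + I (N w) * D n w) ^+ 2 <= N w ^+ 2 + V w * D n w + D n w ^+ 2.
  rewrite /V /I indicE; case: (_ \in _) => /=; first by rewrite mul1r; lra.
  by rewrite mul0r addr0 mulr0 mul0r addr0 lerDl sqr_ge0.
have iN1 : P.-integrable setT (EFin \o (fun w => (N w + I (N w) * D n w) ^+ 2)).
  apply: (le_integrable measurableT _ _ iR) => [|w _].
    by apply/measurable_EFinP; apply: measurable_funX; exact: (mN eps n.+1).
  rewrite /= lee_fin ger0_norm ?sqr_ge0//.
  exact: le_trans (le w) (ler_norm _).
split=> //; rewrite big_ord_recr /=.
apply: (le_trans (le_Rintegral measurableT iN1 iR (fun w _ => le w))).
rewrite RintegralD// RintegralD//.
by rewrite {2}/Rintegral (VD0 _ (sub_sigma_algebra_setT (sG n)))/= addr0 lerD2r.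
Qed.

(** A sum that has left []-eps, eps[] never returns, so being inside at time [n] means that no
    increment was dropped. *)
Lemma stopped_sum_stays eps n w : `|stopped_sum eps n w| < eps ->
  stopped_sum eps n w = \sum_(0 <= k < n) D k w.
Proof.
elim: n => [|n IH] /=; first by rewrite big_geq.
rewrite indicE mem_setE in_itv/= big_nat_recr//= -ltr_norml.
by have [/IH ->|h] := ltP `|stopped_sum eps n w| eps;
  rewrite ?mul1r// mul0r addr0 ltNge h.
Qed.

(** After an exit all increments are multiplied by [0]. Hence a single time [n] records every exit
    up to [n]. *)
Lemma stopped_sum_frozen eps m n w : (m <= n)%N ->
  eps <= `|stopped_sum eps m w| -> eps <= `|stopped_sum eps n w|.
Proof.
elim: n => [|n IH]; first by rewrite leqn0 => /eqP ->.
rewrite leq_eqVlt => /predU1P[->//|]; rewrite ltnS => /IH {}IH /IH /= h.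
by rewrite indicE mem_setE in_itv/= -ltr_norml ltNge h mul0r addr0.
Qed.

(** Chebyshev's inequality for the second moment of the stopped sum. *)
Lemma measure_stopped_sum_ge (eps : R) n : 0 < eps ->
  (P [set w | (eps <= `|stopped_sum eps n w|)%R] <=
    (eps ^- 2 * \sum_(k < n) \int[P]_w D k w ^+ 2)%:E)%E.
Proof.
move=> e0; set A := [set w | _].
have mA : measurable A by exact: measurable_norm_ge.
have [iN le] := stopped_sum_sqr eps n.
rewrite -[leLHS]fineK ?fin_num_measure// lee_fin ler_pdivlMl ?exprn_gt0//.
apply: le_trans le.
rewrite -(Rintegral_cst P mA) Rintegral_mkcond.
have ic : P.-integrable setT (EFin \o ((fun _ => eps ^+ 2) \_ A)).
  rewrite -restrict_EFin; apply/(integrable_mkcond _ mA).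
  exact: finite_measure_integrable_cst.
apply: le_Rintegral => // w _; rewrite patchE; case: ifPn => [|_]; last exact: sqr_ge0.
rewrite inE => Aw.
by rewrite -[leRHS]real_normK ?num_real// ler_sqr// nnegrE// ltW.
Qed.

(** An exit of the plain sums forces one of the stopped sums, whose exit events increase with [n];
    continuity from below then passes the Chebyshev bound to their union. *)
Lemma kolmogorov_maximal (eps : R) : 0 < eps ->
  (P (\bigcup_n [set w | (eps <= `|\sum_(0 <= k < n) D k w|)%R]) <=
    (eps ^- 2)%:E * \sum_(0 <= k <oo) (\int[P]_w D k w ^+ 2)%:E)%E.
Proof.
move=> e0; set A := fun n => [set w | eps <= `|stopped_sum eps n w|].
have mA n : measurable (A n) by exact: measurable_norm_ge.
apply: (@le_trans _ _ (P (\bigcup_n A n))).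
  apply: le_measure; rewrite ?inE; [|exact: bigcup_measurable|].
    by apply: bigcup_measurable => n _; exact/measurable_norm_ge/measurable_sum.
  move=> w [n _ /= Sn]; exists n => //=; rewrite /A /= leNgt; apply/negP => h.
  by move: (h); rewrite (stopped_sum_stays h) ltNge Sn.
have ndA : nondecreasing_seq A.
  by move=> m n mn; apply/subsetPset => w /=; exact: stopped_sum_frozen.
have cvP : P \o A @ \oo --> P (\bigcup_n A n).
  by apply: nondecreasing_cvg_mu => //; exact: bigcup_measurable.
rewrite -(cvg_lim (@ereal_hausdorff R) cvP).
apply: lime_le; first by apply/cvg_ex; eexists; exact: cvP.
near=> n => /=; apply: (le_trans (measure_stopped_sum_ge n e0)).
rewrite EFinM lee_wpmul2l ?lee_fin ?invr_ge0 ?sqr_ge0//.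
rewrite -sumEFin -(big_mkord xpredT (fun k => (\int[P]_w D k w ^+ 2)%:E)).
apply: nneseries_lim_ge => k _ _.
by rewrite lee_fin; apply: Rintegral_ge0 => w _; exact: sqr_ge0.
Unshelve. all: by end_near.
Qed.

End stopped_sums.

(** * Almost sure convergence of martingale difference series *)

(** The maximal inequality applied to the increments from [m] on is governed by a tail of a
    convergent series, so almost surely the partial sums are Cauchy. *)
Lemma ae_cvg_series_condexp_zero {d} {T : measurableType d} {R : realType}
    (P : probability T R) (G : nat -> set (set T)) (D : nat -> T -> R) :
  (forall n, is_sub_sigma_algebra (G n)) ->
  (forall n, G n `<=` G n.+1) ->
  (forall n, measurable_wrt (G n.+1) (D n)) ->
  (forall n, condexp_zero P (G n) (D n)) ->
  (\sum_(0 <= n <oo) \int[P]_w (D n w ^+ 2)%:E < +oo)%E ->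
  {ae P, forall w, cvgn (series (fun n => D n w))}.
Proof.
move=> sG GS GD D0 sD.
have mD n : measurable_fun setT (D n) := measurable_wrt_fun (sG _) (GD n).
have I0 n : (0 <= \int[P]_w (D n w ^+ 2)%:E)%E.
  by apply: integral_ge0 => w _; rewrite lee_fin sqr_ge0.
have iD2 n : P.-integrable setT (EFin \o (fun w => D n w ^+ 2)).
  apply/integrableP; split.
    by apply/measurable_EFinP; exact: measurable_funX.
  apply: le_lt_trans sD.
  under eq_integral do rewrite /= ger0_norm ?sqr_ge0//.
  apply: le_trans (nneseries_lim_ge n.+1 (fun k _ _ => I0 k)).
  by rewrite big_nat_recr//= leeDr// sume_ge0.
have IE n : (\int[P]_w (D n w ^+ 2)%:E = (\int[P]_w D n w ^+ 2)%:E)%E.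
  by rewrite /Rintegral fineK//; exact: integrable_fin_num (iD2 n).
pose B (eps : R) m := \bigcup_n [set w | eps <= `|\sum_(0 <= k < n) D (k + m)%N w|].
have mB eps m : measurable (B eps m).
  apply: bigcup_measurable => n _.
  by apply/measurable_norm_ge; exact: measurable_sum.
have PB (eps : R) m : 0 < eps ->
    (P (B eps m) <= (eps ^- 2)%:E * \sum_(m <= k <oo) \int[P]_w (D k w ^+ 2)%:E)%E.
  move=> e0; rewrite -nneseries_addn//.
  under eq_eseriesr do rewrite IE.
  apply: (@kolmogorov_maximal _ _ _ P (fun n => G (n + m)%N)) => // n.
  exact: GD.
have PB0 (eps : R) : 0 < eps -> P.-negligible (\bigcap_m B eps m).
  move=> e0; have mZ : measurable (\bigcap_m B eps m) by exact: bigcap_measurable.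
  apply/negligibleP => //; apply/eqP; rewrite eq_le measure_ge0 andbT.
  have tail0 : (fun m => (eps ^- 2)%:E * \sum_(m <= k <oo) \int[P]_w (D k w ^+ 2)%:E)%E
      @ \oo --> 0%E.
    rewrite -[X in _ --> X](mule0 (eps ^- 2)%:E).
    by apply: cvgeZl => //; apply: nneseries_tail_cvg.
  rewrite -(cvg_lim (@ereal_hausdorff R) tail0); apply: lime_ge.
    by apply/cvg_ex; eexists; exact: tail0.
  near=> m; apply: le_trans (PB eps m e0); apply: le_measure; rewrite ?inE//.
  exact: bigcap_inf.
(* The thresholds [1 / (j + 1)] suffice for all [eps], and countably many null sets have a null
   union. *)
have : P.-negligible (\bigcup_j \bigcap_m B j.+1%:R^-1 m).
  by apply: negligible_bigcup => j; apply: PB0; rewrite invr_gt0.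
apply: negligibleS => w /= ncv; apply: contrapT => nB; apply: ncv.
have small j : exists m, forall n, `|\sum_(0 <= k < n) D (k + m)%N w| < j.+1%:R^-1.
  apply: contrapT => nm; apply: nB; exists j => // m _; apply: contrapT => nBm.
  apply: nm; exists m => n; rewrite ltNge; apply/negP => h; apply: nBm.
  by exists n.
apply/cauchy_cvgP/cauchy_seriesP => e e0.
have [j _ /(_ j (leqnn j)) je] := near_infty_natSinv_lt (PosNum (divr_gt0 e0 (ltr0n R 2))).
have [m Hm] := small j.
have Hm' n : (m <= n)%N -> `|\sum_(m <= k < n) D k w| < e / 2.
  move=> mn; apply: lt_trans je; suff -> : \sum_(m <= k < n) D k w =
    \sum_(0 <= k < n - m) D (k + m)%N w by exact: Hm.
  by rewrite -{1}[m]add0n big_addn.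
exists ([set n | (m <= n)%N], [set n | (m <= n)%N]).
  by split; exists m.
move=> [p q] [/= mp mq]; have [pq|/ltnW qp] := leqP p q; last first.
  by rewrite big_geq ?normr0.
have -> : \sum_(p <= k < q) D k w =
    \sum_(m <= k < q) D k w - \sum_(m <= k < p) D k w.
  by rewrite (big_cat_nat mp pq)/= addrAC subrr add0r.
apply: le_lt_trans (ler_normB _ _) _; rewrite [ltRHS]splitr.
by rewrite ltrD// Hm'.
Unshelve. all: by end_near.
Qed.

(** * The argument along one path *)

(** The value at [0] is [1], so the modulus is always [1] and multiplying by the sign never loses
    the noise term. *)
Definition pmsign (R : realType) (x : R) : R := if 0 <= x then 1 else -1.

Lemma pmsign_mul (R : realType) (x : R) : pmsign x * x = `|x|.
Proof.
rewrite /pmsign; case: ifPn => [x0|]; first by rewrite mul1r ger0_norm.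
by rewrite -ltNge => x0; rewrite mulN1r ltr0_norm.
Qed.

Lemma normr_pmsign (R : realType) (x : R) : `|pmsign x| = 1.
Proof. by rewrite /pmsign; case: ifP; rewrite ?normrN normr1. Qed.

Lemma measurable_pmsign (R : realType) : measurable_fun [set: R] (@pmsign R).
Proof.
have -> : @pmsign R = (fun x => 2 * \1_(`[0, +oo[%classic : set R) x - 1).
  apply/funext => x; rewrite /pmsign indicE mem_setE in_itv/= andbT.
  by case: ifP => _ /=; lra.
by apply: measurable_funB => //; exact: measurable_funM.
Qed.

(** Here [y], [t], [u] stand for [X - xs], [T - xs], [W] on a fixed path. Dividing by [p n] absorbs
    the factors [1 + beta n <= expR (beta n)], and [p] stays between [1] and [expR S]. *)
Lemma pathwise_dvoretzky (R : realType) (y t u alpha beta gamma : nat -> R) (S : R) :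
  (forall n, y n.+1 = t n + u n) ->
  (forall n, `|t n| <= Num.max (alpha n) ((1 + beta n) * `|y n| - gamma n)) ->
  alpha @ \oo --> (0 : R) ->
  (forall n, 0 <= alpha n) -> (forall n, 0 <= beta n) -> (forall n, 0 <= gamma n) ->
  (forall n, series beta n <= S) -> series gamma @ \oo --> +oo ->
  cvgn (series (fun n => pmsign (t n) / expR (series beta n.+1) * u n)) ->
  y @ \oo --> (0 : R).
Proof.
move=> yE tle alpha_cvg alpha0 beta0 gamma0 betaS gammay cv.
pose p n := expR (series beta n).
have p0 n : 0 < p n by exact: expR_gt0.
have p1 n : 1 <= p n.
  by rewrite -expR0 ler_expR sumr_ge0.
have pS n : p n <= expR S by rewrite ler_expR.
have pSr n : p n.+1 = p n * expR (beta n) by rewrite /p seriesSr expRD.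
set delta := (fun n => _) in cv.
have norm_u n : `|u n| <= expR S * `|delta n|.
  rewrite /delta -/(p _) !normrM normr_pmsign mul1r mulrA ler_peMl//.
  by rewrite ger0_norm ?invr_ge0 ?(ltW (p0 _))// ler_pdivlMr// mul1r.
have u_cvg : u @ \oo --> (0 : R).
  apply/norm_cvg0P.
  apply: (@squeeze_cvgr _ _ _ _ (cst 0) (fun n => expR S * `|delta n|)).
  - by near=> n; rewrite normr_ge0 norm_u.
  - exact: cvg_cst.
  - rewrite -[X in _ --> X](mulr0 (expR S)); apply: cvgMl_tmp.
    by apply/norm_cvg0P; exact: cvg_series_cvg_0.
have eta_cvg : (fun n => `|y n| / p n) @ \oo --> (0 : R).
  (* If [|t n|] is at most [alpha n] or [|u n|], then [|t n| + |u n|] is at most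
     [alpha n + 2 * |u n|]; this is the reset level. *)
  apply: (@max_recursion_cvg0 R _ (fun n => alpha n + 2 * `|u n|)
    (fun n => gamma n / p n.+1) delta) => //.
  - by move=> n; rewrite divr_ge0// ltW.
  - rewrite -[X in _ --> X]addr0 -[X in _ + X](mulr0 2).
    by apply: cvgD => //; apply: cvgMl_tmp; exact/norm_cvg0P.
  - by move=> n; rewrite divr_ge0// ltW.
  (* Since [p] is bounded by [expR S], dividing by it preserves the divergence of [series gamma]. *)
  - apply/cvgryPge => A; near=> n.
    apply: (@le_trans _ _ ((expR S)^-1 * series gamma n)).
      rewrite ler_pdivlMl ?expR_gt0//; near: n.
      by move/cvgryPge: gammay; apply.
    rewrite /series /= mulr_sumr ler_sum// => k _.
    by rewrite mulrC ler_wpM2l// lef_pV2 ?posrE ?expR_gt0.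
  - move=> n; rewrite le_max.
    have [small|large] := leP `|t n| (Num.max (alpha n) `|u n|).
      apply/orP; left; rewrite ler_pdivrMr// yE.
      apply: (@le_trans _ _ (alpha n + 2 * `|u n|)).
        apply: le_trans (ler_normD _ _) _; have := normr_ge0 (u n); have := alpha0 n.
        by move: small; rewrite le_max => /orP[]; lra.
      by rewrite ler_peMr// addr_ge0// mulr_ge0.
    apply/orP; right; move: large; rewrite gt_max => /andP[ta tu].
    (* As [|t n|] exceeds [alpha n], the bound must come from the other branch of the maximum. *)
    have tb : `|t n| <= (1 + beta n) * `|y n| - gamma n.
      by have := tle n; rewrite le_max leNgt ta.
    have eb : (1 + beta n) * `|y n| <= expR (beta n) * `|y n|.
      by rewrite ler_wpM2r// expR_ge1Dx.
    (* [t n] dominates [u n], so it carries the sign of the sum. *)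
    have -> : `|y n.+1| = `|t n| + pmsign (t n) * u n.
      rewrite yE -(pmsign_mul (t n)) -mulrDr.
      transitivity `|pmsign (t n) * (t n + u n)|.
        by rewrite normrM normr_pmsign mul1r.
      rewrite ger0_norm// mulrDr pmsign_mul -lerBlDr sub0r.
      apply: le_trans (ltW tu).
      by rewrite -[leRHS]mul1r -(normr_pmsign (t n)) -normrM -normrN ler_norm.
    have -> : `|y n| / p n + delta n - gamma n / p n.+1 =
        (expR (beta n) * `|y n| - gamma n + pmsign (t n) * u n) / p n.+1.
      rewrite /delta -/(p _) pSr; field.
      by rewrite !gt_eqF ?expR_gt0.
    by rewrite ler_pM2r ?invr_gt0//; lra.
apply/norm_cvg0P.
apply: (@squeeze_cvgr _ _ _ _ (cst 0) (fun n => expR S * (`|y n| / p n))).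
- near=> n; rewrite normr_ge0 /= mulrCA ler_peMr//.
  by rewrite ler_pdivlMr// mul1r.
- exact: cvg_cst.
- by rewrite -[X in _ --> X](mulr0 (expR S)); exact: cvgMl_tmp.
Unshelve. all: by end_near.
Qed.

(** * From almost every path to probability one *)

(** Convergence is written with countably many thresholds. Measurability turns a negligible
    complement into a set of probability zero. *)
Lemma measurable_cvg_to {d} {T : measurableType d} {R : realType}
    (X : nat -> T -> R) (x : R) : (forall n, measurable_fun [set: T] (X n)) ->
  measurable [set w | (fun n => X n w) @ \oo --> x].
Proof.
move=> mX.
have -> : [set w | (fun n => X n w) @ \oo --> x] =
    \bigcap_j \bigcup_m \bigcap_n ~` [set w | j.+1%:R^-1 <= `|X (n + m)%N w - x|].
  apply/seteqP; split=> w /= => [cv j _|H].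
    have j0 : 0 < j.+1%:R^-1 :> R by rewrite invr_gt0.
    move/cvgrPdist_lt: cv => /(_ _ j0)[m _ Hm]; exists m => // n _ /=.
    by apply/negP; rewrite -ltNge distrC; apply: Hm; exact: leq_addl.
  apply/cvgrPdist_lt => e e0.
  have [j _ /(_ j (leqnn j)) /= je] := near_infty_natSinv_lt (PosNum e0).
  have [m _ Hm] := H j I; exists m => // n /= mn.
  have := Hm (n - m)%N I; rewrite /= subnK// => /negP; rewrite -ltNge distrC.
  by move=> h; exact: lt_trans je.
apply: bigcap_measurable => // j _; apply: bigcup_measurable => m _.
apply: bigcap_measurable => // n _; apply: measurableC; apply: measurable_norm_ge.
exact: measurable_funB.
Qed.

Theorem mainTheorem1 (d : measure_display) (Omega : measurableType d)
  (R : realType) (P : probability Omega R)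
  (F : nat -> set (set Omega))
  (X : nat -> Omega -> R) (Tn : forall n : nat, n.-tuple R -> R)
  (W : nat -> Omega -> R)
  (alpha beta gamma : nat -> R) (xs : R) :
  (forall n, (1 <= n)%N -> is_sub_sigma_algebra (F n)) ->
  (forall m n, (1 <= m)%N -> (m <= n)%N -> F m `<=` F n) ->
  (forall n, (1 <= n)%N -> measurable_wrt (F n) (X n)) ->
  (forall n, (1 <= n)%N -> measurable_fun setT (Tn n)) ->
  (forall n, (1 <= n)%N -> measurable_wrt (F n.+1) (W n)) ->
  (forall n, (1 <= n)%N -> forall w,
      X n.+1 w = Tn n [tuple X i.+1 w | i < n] + W n w) ->
  (forall n, (1 <= n)%N -> condexp_zero P (F n) (W n)) ->
  (\sum_(1 <= n <oo) 'E_P[fun w => (W n w ^+ 2)%R] < +oo)%E ->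
  (forall n, (1 <= n)%N -> 0 <= alpha n) ->
  (forall n, (1 <= n)%N -> 0 <= beta n) ->
  (forall n, (1 <= n)%N -> 0 <= gamma n) ->
  alpha @ \oo --> (0 : R) ->
  (\sum_(1 <= n <oo) (beta n)%:E < +oo)%E ->
  (\sum_(1 <= n <oo) (gamma n)%:E = +oo)%E ->
  (forall n, (1 <= n)%N -> forall x : n.-tuple R,
      `|Tn n x - xs| <= Num.max (alpha n)
           ((1 + beta n) * `|nth 0 x n.-1 - xs| - gamma n)) ->
  P [set w | (fun n => X n w) @ \oo --> xs] = 1%E.
Proof.
move=> sF Fmono FX mT FW XE W0 sW alpha0 beta0 gamma0 alpha_cvg sbeta sgamma Tle.
have sF1 n : is_sub_sigma_algebra (F n.+1) := sF n.+1 isT.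
have mX n : measurable_fun setT (X n.+1).
  exact: measurable_wrt_fun (sF1 n) (FX n.+1 isT).
(* Time starts at [1] in the statement and at [0] in the lemmas, hence the shift of every sequence
   by one. *)
have shiftE : [set w | (fun n => X n w) @ \oo --> xs] =
    [set w | (fun n => X n.+1 w) @ \oo --> xs].
  by congr mkset; apply/funext => w; rewrite -(cvg_shiftS (fun n => X n w)).
pose x n w := Tn n.+1 [tuple X i.+1 w | i < n.+1].
pose b n := beta n.+1.
(* The predictable factor of the increments [delta n]: it is known at time [n.+1] and bounded by
   [1]. *)
pose V n w := pmsign (x n w - xs) / expR (series b n.+1).
pose D n w := V n w * W n.+1 w.
have b0 n : 0 <= b n by exact: beta0.
have [S bS] : exists S : R, forall n, series b n <= S.
  exists (fine (\sum_(1 <= n <oo) (beta n)%:E)%E) => n.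
  have p0 : (0 <= \sum_(1 <= n <oo) (beta n)%:E)%E.
    by apply: nneseries_ge0 => k k1 _; rewrite lee_fin beta0.
  rewrite -lee_fin fineK ?ge0_fin_numE// /series /= -sumEFin.
  rewrite -(big_add1 _ _ 0 n.+1 xpredT (fun k => (beta k)%:E)).
  by apply: nneseries_lim_ge => k k1 _; rewrite lee_fin beta0.
have gy : series (fun n => gamma n.+1) @ \oo --> +oo.
  have : (fun n => \sum_(1 <= k < n) (gamma k)%:E)%E @ \oo --> +oo%E.
    rewrite -sgamma; apply: is_cvg_nneseries => k k1 _.
    by rewrite lee_fin gamma0.
  move=> /cvgeyPge gy; apply/cvgryPge => A; near=> n.
  have : (A%:E <= \sum_(1 <= k < n) (gamma k)%:E)%E by near: n; exact: gy.
  rewrite sumEFin lee_fin => /le_trans; apply.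
  rewrite /series /= -(big_add1 _ _ 0 n.+1 xpredT gamma).
  (* For [n > 0] the shifted series has the extra nonnegative term [gamma n]. *)
  have [->|n0] := posnP n; first by rewrite !big_geq.
  by rewrite [leRHS]big_nat_recr//= lerDl gamma0.
have Fx n : measurable_wrt (F n.+1) (x n).
  apply/(measurable_wrtP (sF1 _)).
  apply: measurableT_comp; first exact: mT.
  apply/measurable_fun_tnthP => i.
  rewrite (_ : _ \o _ = X i.+1); last by apply/funext => w /=; rewrite tnth_mktuple.
  apply/(measurable_wrtP (sF1 _)) => B mB.
  by apply: (@Fmono i.+1 n.+1) => //; exact: FX.
have FV n : measurable_wrt (F n.+1) (V n).
  apply: (measurable_wrt_comp (f := fun z => pmsign (z - xs) / expR (series b n.+1))) => //.
  apply: measurable_funM => //.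
  apply: measurableT_comp; first exact: measurable_pmsign.
  exact: measurable_funB.
have V1 n w : `|V n w| <= 1.
  rewrite normrM normr_pmsign mul1r ger0_norm ?invr_ge0 ?expR_ge0//.
  by rewrite invf_le1 ?expR_gt0// -expR0 ler_expR sumr_ge0.
have FSub n : F n.+1 `<=` F n.+2 by exact: Fmono.
have FD n : measurable_wrt (F n.+2) (D n).
  apply/(measurable_wrtP (sF1 _)); apply: measurable_funM.
    by apply/(measurable_wrtP (sF1 _)) => B mB; exact/FSub/FV.
  exact/(measurable_wrtP (sF1 _))/FW.
have mW n : measurable_fun setT (W n.+1).
  exact: measurable_wrt_fun (sF1 n.+1) (FW n.+1 isT).
have cvD : {ae P, forall w, cvgn (series (fun n => D n w))}.
  apply: (@ae_cvg_series_condexp_zero _ _ _ P (fun n => F n.+1)) => //.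
  - by move=> n; exact: (condexp_zero_mul (sF1 _) (W0 n.+1 isT) (FV n) (V1 n)).
  (* As [|V n w| <= 1], the second moment of [D n] is at most that of [W n.+1]. *)
  - apply: le_lt_trans sW.
    rewrite -(@nneseries_addn R (fun n => 'E_P[fun w => (W n w ^+ 2)%R])%E 1); last first.
      by move=> n; apply: expectation_ge0 => w; exact: sqr_ge0.
    apply: lee_nneseries => [n _ _|n _].
      by apply: integral_ge0 => w _; rewrite lee_fin sqr_ge0.
    rewrite addn1 unlock; apply: ge0_le_integral => //.
    + by move=> w _; rewrite lee_fin sqr_ge0.
    + apply/measurable_EFinP; apply: measurable_funX.
      exact: measurable_wrt_fun (sF1 _) (FD n).
    + by apply/measurable_EFinP; exact: measurable_funX.
    + move=> w _; rewrite lee_fin /D exprMn ler_piMl ?sqr_ge0//.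
      by rewrite -[leLHS]real_normK ?num_real// expr_le1.
have mA := measurable_cvg_to xs mX.
rewrite shiftE -[X in P X]setCK probability_setC; last exact: measurableC.
suff -> : P (~` [set w | (fun n => X n.+1 w) @ \oo --> xs]) = 0%E by rewrite sube0.
apply/negligibleP; first exact: measurableC.
apply: negligibleS cvD => w /= ncv cv; apply: ncv; apply/subr_cvg0.
apply: (@pathwise_dvoretzky R _ (fun n => x n w - xs) (fun n => W n.+1 w)
  (fun n => alpha n.+1) b (fun n => gamma n.+1) S) => //.
- by move=> n; rewrite XE// addrAC.
- move=> n; apply: le_trans (Tle n.+1 isT _) _.
  (* The last entry of the tuple is [X n.+1 w], the current state. *)
  by rewrite /= (nth_mktuple _ _ ord_max).
- by rewrite cvg_shiftS.
- by move=> n; exact: alpha0.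
- by move=> n; exact: gamma0.
Unshelve. all: by end_near.
Qed.
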